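(* Let $\mathcal F_n$ be the set of words in $\{1,2\}^*$ of length $n$ with no two consecutive ones, and let $\phi$ be Foata's fundamental bijection. The set $\phi^{-1}(\mathcal F_n)$ consists of all $v\in\{1,2\}^*$ of length $n$ satisfying the following two conditions. (i) If $v$ has a $1$-run $r$ as a prefix or suffix, then $l(r)\le1$ or $l(r)\le2$, respectively. (ii) For any run $r$ of $v$ which is neither the prefix run nor the suffix run, $l(r)\le2$ if $r$ is a $1$-run and $l(r)\ge2$ if $r$ is a $2$-run.
   Context: $\mathbb P^*$ is the set of all finite words in the positive integers; $l(w)$ is the length of a word $w$. A run in $w=b_1b_2\ldots b_n$ is a maximal factor $r=b_ib_{i+1}\ldots b_j$ with $b_i=b_{i+1}=\cdots=b_j$; it is a $k$-run if the common value of its letters is $k$. It is called the prefix run if $i=1$ and the suffix run if $j=n$ (a run may be both, in which case both parts of (i) apply). Foata's fundamental bijection $\phi:\mathbb P^*\to\mathbb P^*$: $\phi(\epsilon)=\epsilon$ for the empty word $\epsilon$. For $v=a_1\ldots a_n$ with $n\ge1$, define $w_1=a_1$ and, given $w_i=b_1\ldots b_i$, define $w_{i+1}$ as follows. If $b_i\le a_{i+1}$ (respectively $b_i>a_{i+1}$), factor $w_i=f_1f_2\cdots f_k$ uniquely so that in each factor every letter is $>a_{i+1}$ (respectively $\le a_{i+1}$) except its last letter, which is $\le a_{i+1}$ (respectively $>a_{i+1}$). Let $g_j$ be obtained from $f_j$ by moving its last letter to the front, and set $w_{i+1}=g_1g_2\cdots g_k\,a_{i+1}$. Then $\phi(v)=w_n$.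 The map $\phi$ is a bijection preserving the multiset of letters. *)

(* Defs.v *)
From mathcomp Require Import all_boot.

Set Implicit Arguments.
Unset Strict Implicit.
Unset Printing Implicit Defensive.

(* Words are sequences of natural numbers.  Positions are numbered from 0, so
   that b_i is [nth 0 w i.-1]. *)

Definition positive_word (w : seq nat) : bool := all (leq 1) w.

Definition word12 (w : seq nat) : bool := all (mem [:: 1; 2]) w.

(* Cuts [acc ++ w] after each letter of [w] that satisfies [p].  When the last
   letter of [w] satisfies [p], [cut_after p [::] w] is the unique factorization
   of [w] in which each factor has exactly one letter satisfying [p], namely its
   last letter: see [flatten_cut_after] and [cut_afterP]. *)
Fixpoint cut_after (p : pred nat) (acc w : seq nat) : seq (seq nat) :=
  match w with
  | [::] => if nilp acc then [::] else [:: acc]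
  | b :: w' =>
      if p b then rcons acc b :: cut_after p [::] w'
      else cut_after p (rcons acc b) w'
  end.

(* [w] is meant to be nonempty: the default value of [last] is never used by
   [foata].  [rotr 1] moves the last letter of a factor to the front. *)
Definition foata_step (w : seq nat) (a : nat) : seq nat :=
  let p : pred nat := if last 0 w <= a then fun c => c <= a
                      else fun c => a < c in
  rcons (flatten [seq rotr 1 f | f <- cut_after p [::] w]) a.

Definition foata (v : seq nat) : seq nat :=
  match v with
  | [::] => [::]
  | a1 :: v' => foldl foata_step [:: a1] v'
  end.

Definition no_consecutive_ones (n : nat) (w : seq nat) : bool :=
  [&& word12 w, size w == n & ~~ infix [:: 1; 1] w].

Definition constant_factor (w : seq nat) (i j : nat) : Prop :=
  i <= j < size w /\ forall m, i <= m <= j -> nth 0 w m = nth 0 w i.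

(* The positions i, ..., j (inclusive) of [w] form a run. *)
Definition is_run (w : seq nat) (i j : nat) : Prop :=
  constant_factor w i j /\
  forall i' j', i' <= i -> j <= j' -> constant_factor w i' j' ->
    i' = i /\ j' = j.

Definition is_krun (k : nat) (w : seq nat) (i j : nat) : Prop :=
  is_run w i j /\ nth 0 w i = k.

Definition run_length (i j : nat) : nat := (j - i).+1.

Definition is_prefix_run (w : seq nat) (i j : nat) : Prop :=
  is_run w i j /\ i = 0.

Definition is_suffix_run (w : seq nat) (i j : nat) : Prop :=
  is_run w i j /\ j.+1 = size w.

Definition end_runs_condition (v : seq nat) : Prop :=
  forall i j, is_krun 1 v i j ->
    (is_prefix_run v i j -> run_length i j <= 1) /\
    (is_suffix_run v i j -> run_length i j <= 2).

Definition inner_runs_condition (v : seq nat) : Prop :=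
  forall i j, is_run v i j -> ~ is_prefix_run v i j -> ~ is_suffix_run v i j ->
    (is_krun 1 v i j -> run_length i j <= 2) /\
    (is_krun 2 v i j -> 2 <= run_length i j).

Lemma flatten_cut_after (p : pred nat) (acc w : seq nat) :
  flatten (cut_after p acc w) = acc ++ w.
Proof.
elim: w acc => [|b w IHw] acc /=; first by case: acc => [|x acc] //=; rewrite !cats0.
by case: ifP => _ /=; rewrite IHw ?cat0s cat_rcons.
Qed.

Lemma cut_afterP (p : pred nat) (w f : seq nat) :
  p (last 0 w) -> w != [::] -> f \in cut_after p [::] w ->
  exists u x, [/\ f = rcons u x, all (predC p) u & p x].
Proof.
case: w => // b w /= pl _.
have {pl}: p (last b w) || ~~ true by rewrite pl.
rewrite orbF => pl.
suff H (acc s : seq nat) : all (predC p) acc -> (s != [::]) || nilp acc ->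
    (s != [::] -> p (last 0 s)) -> f \in cut_after p acc s ->
    exists u x, [/\ f = rcons u x, all (predC p) u & p x].
  by apply: (H [::] (b :: w)).
elim: s acc => [|c s IHs] acc /= acc_np.
  by move=> ->.
move=> _ /(_ isT) pc; case: ifP => pcc.
  rewrite inE => /orP[/eqP->|]; first by exists acc, c.
  by apply: IHs => //; [rewrite orbT | case: (s) pc].
apply: IHs; rewrite ?all_rcons /= ?pcc //.
- by case: (s) pc => //=; rewrite pcc.
- by case: (s) pc.
Qed.

(* Main.v *)
Require Import Defs.
From mathcomp Require Import all_boot.

Set Implicit Arguments.
Unset Strict Implicit.
Unset Printing Implicit Defensive.

(** On letters 1 and 2, one step of Foata's map is very simple.  Appending a 2
    cuts after every letter, so nothing moves; appending a 1 cuts the current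
    word [w] after each occurrence of its own last letter, and rotating all
    these factors amounts to moving the last letter of [w] to its front.  Hence,
    writing phi for the map, phi(v2) = phi(v)2, and phi(v1) = x u 1 whenever
    phi(v) = u x ([foata_rcons2] and [foata_rcons1]).

    Since phi keeps the last letter, applying this twice to a word z y x 1
    shows that y is adjacent to a 1 in phi(z y x 1), and that the other
    occurrences of 11 in this word correspond to those in phi(z y x).  So
    phi(z y x 1) avoids 11 exactly when phi(z y x) does and y is not 1
    ([has11_foata_rcons1]).  By induction, phi(v) avoids 11 if and only if v
    does not begin with 11 and no two ones are at distance two in v, that is, v
    has neither 111 nor 121 as a factor ([foata_spread_ones]).

    These three forbidden patterns are the conditions on runs: a prefix 11 is a
    prefix 1-run that is too long, a factor 111 lies in a 1-run of length at
    least three, and a factor 121 is an inner 2-run of length one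
    ([spread_ones_runs]). *)

(** * Foata's map on words in 1 and 2 *)

(** The formula covers the empty word too, because [foata_step [::] a] is [[:: a]]. *)
Lemma foata_rcons (v : seq nat) (a : nat) :
  foata (rcons v a) = foata_step (foata v) a.
Proof. by case: v => [|b v] //=; rewrite -cats1 foldl_cat. Qed.

Lemma perm_foata (v : seq nat) : perm_eq (foata v) v.
Proof.
elim/last_ind: v => // v a IHv; rewrite foata_rcons /foata_step.
set p := (if _ then _ else _ : pred nat).
rewrite -!cats1 perm_cat2r; apply: perm_trans IHv.
rewrite -[X in perm_eq _ X](flatten_cut_after p [::] (foata v)).
elim: (cut_after _ _ _) => //= f fs IHfs.
by apply: perm_cat => //; rewrite perm_rotr.
Qed.

Lemma rotr_factors_all (p : pred nat) (w : seq nat) : all p w ->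
  flatten [seq rotr 1 f | f <- cut_after p [::] w] = w.
Proof. by elim: w => //= b w IHw /andP[-> /IHw] /= ->. Qed.

(** Each factor is some copies of [b] followed by one [a], and rotating it
    turns b...ba into ab...b: the occurrences of [a] move to the front of their
    factors, so that the word as a whole is shifted cyclically by one letter.
    The pending factor [nseq k b] is there for the induction on [u]. *)
Lemma rotr_factors_binary (p : pred nat) (a b : nat) (k : nat) (u : seq nat) :
  p a -> ~~ p b -> all (mem [:: a; b]) u ->
  flatten [seq rotr 1 f | f <- cut_after p (nseq k b) (rcons u a)] =
  a :: nseq k b ++ u.
Proof.
move=> pa /negbTE npb; elim: u k => [|c u IHu] k /=.
  by rewrite pa /= rotr1_rcons !cats0.
rewrite !inE => /andP[/orP[]/eqP-> uab].
  by rewrite pa /= rotr1_rcons (IHu 0).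
have nseq_rcons : rcons (nseq k b) b = nseq k.+1 b.
  by elim: k => //= k ->.
by rewrite npb nseq_rcons IHu // -nseq_rcons cat_rcons.
Qed.

Lemma foata_rcons2 (v : seq nat) :
  word12 v -> foata (rcons v 2) = rcons (foata v) 2.
Proof.
rewrite /word12 -(perm_all _ (perm_foata v)) foata_rcons /foata_step => v12.
have le2 : all (fun c => c <= 2) (foata v).
  by apply: sub_all v12 => c; rewrite !inE => /orP[]/eqP->.
rewrite ifT ?rotr_factors_all //.
by case/lastP: (foata v) le2 => // u x; rewrite last_rcons all_rcons => /andP[].
Qed.

Lemma foata_rcons1 (v : seq nat) :
  word12 v -> foata (rcons v 1) = rcons (rotr 1 (foata v)) 1.
Proof.
rewrite /word12 -(perm_all _ (perm_foata v)) foata_rcons /foata_step.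
case/lastP: (foata v) => // u x; rewrite last_rcons all_rcons rotr1_rcons.
case/andP; rewrite !inE => /orP[]/eqP-> u12; congr (rcons _ _).
  (* The last letter is 1: the cuts are after the ones; otherwise, below, they
     are after the twos. *)
  exact: (@rotr_factors_binary _ 1 2 0).
apply: (@rotr_factors_binary _ 2 1 0) => //.
by apply: sub_all u12 => c; rewrite !inE orbC.
Qed.

(** * Consecutive ones in the image *)

Definition has11 (w : seq nat) : bool := infix [:: 1; 1] w.

Lemma has11_rcons (s : seq nat) (y x : nat) :
  has11 (rcons (rcons s y) x) = has11 (rcons s y) || (y == 1) && (x == 1).
Proof.
rewrite /has11 -infix_rev -[in RHS]infix_rev !rev_rcons /=.
by rewrite prefix0s ?andbT [RHS]orbC (andbC (y == 1)) !(eq_sym 1).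
Qed.

Lemma has11_cons (s : seq nat) (x y : nat) :
  has11 (x :: y :: s) = (x == 1) && (y == 1) || has11 (y :: s).
Proof. by rewrite /has11 /= prefix0s andbT !(eq_sym 1). Qed.

(** With phi(v y) = u y, the words phi(v y x) and phi(v y x 1) are u y 2 and
    2 u y 1 if [x] is 2, and y u 1 and 1 y u 1 if [x] is 1.  Either way, the
    only new place where 11 can appear is an adjacency of [y] with a 1. *)
Lemma has11_foata_rcons1 (v : seq nat) (y x : nat) :
  word12 (rcons (rcons v y) x) ->
  has11 (foata (rcons (rcons (rcons v y) x) 1)) =
  has11 (foata (rcons (rcons v y) x)) || (y == 1).
Proof.
move=> v12; rewrite (foata_rcons1 v12).
move: v12; rewrite /word12 all_rcons => /andP[x12 vy12].
have [u foata_vy] : exists u, foata (rcons v y) = rcons u y.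
  by rewrite foata_rcons /foata_step; eexists.
move: x12; rewrite !inE => /orP[]/eqP->.
  rewrite (foata_rcons1 vy12) foata_vy !rotr1_rcons -[rcons (y :: u) 1]/(y :: rcons u 1).
  case: u {foata_vy} => [|z u] /=.
    by rewrite !has11_cons /=; case: (y == 1).
  by rewrite -!rcons_cons has11_cons /= orbC.
rewrite (foata_rcons2 vy12) foata_vy rotr1_rcons.
rewrite -rcons_cons !has11_rcons andbT andbF orbF.
by case: u {foata_vy} => [|z u]; rewrite /= has11_cons.
Qed.

(** The default value 0 of [nth] is not a letter, so the equations themselves
    force the positions to be inside the word. *)
Definition spread_ones (v : seq nat) : Prop :=
  ~ (nth 0 v 0 = 1 /\ nth 0 v 1 = 1) /\
  forall i, ~ (nth 0 v i = 1 /\ nth 0 v i.+2 = 1).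

Lemma spread_ones_rcons2 (v : seq nat) :
  spread_ones (rcons v 2) <-> spread_ones v.
Proof.
have nth1 i : nth 0 (rcons v 2) i = 1 <-> nth 0 v i = 1.
  by rewrite nth_rcons; case: ltngtP => // [?|->]; rewrite nth_default // ltnW.
by split=> -[pre dist]; split=> [[/nth1 v0 /nth1 v1]|i [/nth1 vi /nth1 vi2]];
  [apply: pre | apply: (dist i) | apply: pre | apply: (dist i)].
Qed.

Lemma spread_ones_rcons1 (v : seq nat) (y x : nat) :
  spread_ones (rcons (rcons (rcons v y) x) 1) <->
  spread_ones (rcons (rcons v y) x) /\ y <> 1.
Proof.
set w := rcons (rcons v y) x.
have sz : size w = (size v).+2 by rewrite !size_rcons.
have wE i : i < (size v).+2 -> nth 0 (rcons w 1) i = nth 0 w i.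
  by rewrite nth_rcons sz => ->.
have w_y : nth 0 w (size v) = y.
  by rewrite /w !nth_rcons size_rcons leqnn ltnn eqxx.
have w_1 : nth 0 (rcons w 1) (size v).+2 = 1 by rewrite nth_rcons sz ltnn eqxx.
split=> [[pre dist]|[[pre dist] y1]].
  split; last by move=> y1; apply: (dist (size v)); rewrite wE ?w_y.
  split=> [|i]; first by rewrite -!wE.
  case: (ltnP i.+2 (size v).+2) => lt_i; first by rewrite -!wE // ltnW // ltnW.
  by case=> _; rewrite nth_default ?sz.
split=> [|i]; first by rewrite !wE.
case: (ltngtP i (size v)) => [lt_i|lt_i|->].
- by rewrite !wE // ltnW // ltnW.
- by case=> _; rewrite nth_default // size_rcons sz.
- by rewrite wE // w_y => -[].
Qed.

(** Induction on the last letter.  The words x1 of length two are a base case;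
    they are where the condition on the prefix 11 comes from. *)
Lemma foata_spread_ones (v : seq nat) :
  word12 v -> ~~ has11 (foata v) <-> spread_ones v.
Proof.
elim/last_ind: v => [|v x IHv] v12; first by split=> // _; split=> [[]|i []].
move: (v12); rewrite /word12 all_rcons => /andP[x12 {}/IHv IHv].
have {}v12 : word12 v by move: v12; rewrite /word12 all_rcons => /andP[].
move: x12; rewrite !inE => /orP[]/eqP->; last first.
  apply: iff_trans (iff_sym (spread_ones_rcons2 v)); rewrite foata_rcons2 //.
  suff -> : has11 (rcons (foata v) 2) = has11 (foata v) by [].
  by case/lastP: (foata v) => // u y; rewrite has11_rcons andbF orbF.
case/lastP: v IHv v12 => [|v x1] IHv v12.
  by split=> // _; split=> [[]|[|i] []] //=; rewrite nth_nil.
case/lastP: v IHv v12 => [|v y] IHv v12.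
  move: v12; rewrite /= /word12 /= !inE andbT => /orP[]/eqP->.
    by split=> // -[[]].
  by split=> // _; split=> [[]|[|[|i]] []] //=; rewrite nth_nil.
apply: iff_trans (iff_sym (spread_ones_rcons1 v y x1)).
rewrite has11_foata_rcons1 // negb_or.
by split=> [/andP[/IHv ? /eqP]|[/IHv-> /eqP]].
Qed.

(** * Runs *)

Lemma constant_factor_extl (w : seq nat) (i j : nat) :
  constant_factor w i.+1 j -> nth 0 w i = nth 0 w i.+1 ->
  constant_factor w i j.
Proof.
case=> /andP[lt_ij lt_j] cst eq_i; split=> [|m]; first by rewrite lt_j ltnW.
case/andP; rewrite leq_eqVlt => /orP[/eqP->//|lt_im] le_mj.
by rewrite eq_i; apply: cst; rewrite lt_im.
Qed.

Lemma constant_factor_extr (w : seq nat) (i j : nat) :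
  constant_factor w i j -> j.+1 < size w -> nth 0 w j.+1 = nth 0 w j ->
  constant_factor w i j.+1.
Proof.
case=> /andP[le_ij lt_j] cst lt_j1 eq_j.
split=> [|m]; first by rewrite lt_j1 ltnW.
case/andP=> le_im; rewrite leq_eqVlt => /orP[/eqP->|lt_mj].
  by rewrite eq_j cst ?le_ij /=.
by apply: cst; rewrite le_im.
Qed.

(** Maximality needs to be tested one letter to the left and one letter to the
    right only, since every larger constant factor contains such an extension. *)
Lemma is_runP (w : seq nat) (i j : nat) :
  is_run w i j <->
  [/\ constant_factor w i j,
      0 < i -> nth 0 w i.-1 <> nth 0 w i &
      j.+1 < size w -> nth 0 w j.+1 <> nth 0 w j].
Proof.
split=> [[cst mx]|[cst bl br]].
  split=> //.
    case: i cst mx => //= i cst mx _ eq_i.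
    have [/eqP] := mx i j (leqnSn i) (leqnn j) (constant_factor_extl cst eq_i).
    by rewrite ltn_eqF.
  move=> lt_j eq_j.
  have [_ /eqP] := mx i _ (leqnn i) (leqnSn j) (constant_factor_extr cst lt_j eq_j).
  by rewrite gtn_eqF.
split=> // i' j' le_i le_j [/andP[le_ij' lt_j'] cst'].
have [/andP[le_ij lt_j] _] := cst.
split; apply/eqP.
  rewrite eqn_leq le_i leqNgt; apply/negP => lt_i.
  case: i bl lt_i le_ij {cst le_i} => // i /(_ isT) bl lt_i le_ij; apply: bl.
  have le_ij1 : i.+1 <= j' := leq_trans le_ij le_j.
  by rewrite /= !cst' ?(ltnW lt_i) ?(ltnW le_ij1) ?lt_i ?le_ij1 ?andbT // -ltnS.
rewrite eqn_leq le_j leqNgt andbT; apply/negP => lt_jj.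
apply: br; first exact: leq_ltn_trans lt_j'.
by rewrite !cst' ?lt_jj ?le_j ?(leq_trans le_i) // ltnW.
Qed.

Lemma constant_factor_run (w : seq nat) (i j : nat) :
  constant_factor w i j ->
  exists i' j', [/\ is_run w i' j', i' <= i, j <= j' & nth 0 w i' = nth 0 w i].
Proof.
move=> cst0; have [i' [le_i cst bl]] : exists i',
    [/\ i' <= i, constant_factor w i' j & 0 < i' -> nth 0 w i'.-1 <> nth 0 w i'].
  elim: i cst0 => [|i IHi] cst; first by exists 0.
  have [eq_i|/eqP neq_i] := eqVneq (nth 0 w i) (nth 0 w i.+1).
    have [i' [le_i cst' bl]] := IHi (constant_factor_extl cst eq_i).
    by exists i'; split=> //; apply: leqW.
  by exists i.+1.
have eq_i : nth 0 w i' = nth 0 w i.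
  by have [/andP[le_ij _] _] := cst0; have [_ ->] := cst; rewrite ?le_i.
suff [j' le_j run] : exists2 j', j <= j' & is_run w i' j' by exists i', j'.
(* The left end is now final; push the right end, by induction on the number
   of letters after it. *)
have [k] := ubnP (size w - j).
elim: k j cst {cst0} => // k IHk j cst lt_k.
have [/andP[_ lt_j] _] := cst.
have [[lt_j1 eq_j]|br] : j.+1 < size w /\ nth 0 w j.+1 = nth 0 w j \/
    (j.+1 < size w -> nth 0 w j.+1 <> nth 0 w j).
- case: (ltnP j.+1 (size w)) => lt_j1; last by right.
  by case: (eqVneq (nth 0 w j.+1) (nth 0 w j)) => [|/eqP]; [left|right].
- have [||j' le_j run] := IHk j.+1; first exact: constant_factor_extr.
    by rewrite -ltnS (leq_trans _ lt_k) // ltnS ltn_sub2l.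
  by exists j' => //; apply: ltnW.
by exists j => //; apply/is_runP.
Qed.

Lemma spread_ones_runs (v : seq nat) : word12 v ->
  spread_ones v <-> end_runs_condition v /\ inner_runs_condition v.
Proof.
move=> v12.
have letter m : m < size v -> nth 0 v m = 1 \/ nth 0 v m = 2.
  by move=> /(all_nthP 0 v12); rewrite !inE => /orP[]/eqP->; [left|right].
have lt_size m : nth 0 v m = 1 -> m < size v.
  by case: (ltnP m (size v)) => // ge_m; rewrite nth_default.
split=> [[pre dist]|[ends inner]].
  have le2 i j : is_run v i j -> nth 0 v i = 1 -> run_length i j <= 2.
    case=> -[_ cst] _ v_i; rewrite /run_length leqNgt ltnS ltn_subRL addn1.
    apply/negP => lt_ij; apply: (dist i); split=> //.
    by rewrite cst // lt_ij !leqW.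
  split=> [i j [run v_i]|i j run nprefix nsuffix]; split.
  - case=> _ i0; move: run v_i; rewrite {}i0 => -[[_ cst] _] v_0.
    rewrite /run_length subn0 ltnS leqNgt; apply/negP => lt_j.
    by apply: pre; rewrite cst.
  - by move=> _; apply: le2.
  - by case=> _; apply: le2.
  case=> _ v_i; rewrite /run_length ltnS subn_gt0 ltnNge; apply/negP => le_ji.
  have /is_runP[[/andP[le_ij lt_j] _] bl br] := run.
  have eq_ij : j = i by apply/eqP; rewrite eqn_leq le_ji.
  subst j => {le_ij le_ji}.
  (* An inner 2-run of length one sits between two ones at distance two. *)
  have lt_i1 : i.+1 < size v.
    by rewrite ltn_neqAle lt_j andbT; apply/eqP => eq_i; apply: nsuffix.
  case: i bl br lt_i1 nprefix v_i run lt_j {nsuffix} => [|i] bl br lt_i1 nprefix v_i.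
    by move=> run; case: nprefix.
  move=> _ lt_j.
  apply: (dist i); split.
    by case: (letter i (ltnW lt_j)) => // v2; case: bl; rewrite // v_i.
  by case: (letter _ lt_i1) => // v2; case: br; rewrite // v_i.
split=> [[v0 v1]|i [v_i v_i2]].
  have [|i [j [run le_i le_j eq_i]]] := @constant_factor_run v 0 1.
    by split=> [|[|[|m]]] //=; rewrite ?v0 ?v1 ?lt_size.
  move: le_i; rewrite leqn0 => /eqP i0; subst i.
  have [/(_ (conj run erefl)) + _] := ends 0 j (conj run v0).
  by rewrite /run_length subn0 ltnS leqNgt le_j.
have lt_i2 := lt_size _ v_i2.
have [v_i1|v_i1] := letter _ (ltnW lt_i2).
  (* A factor 111: the run around it violates a bound, whether it is the prefix
     run, the suffix run or neither. *)
  have [|i' [j' [run le_i le_j eq_i]]] := @constant_factor_run v i i.+2.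
    split=> [|m]; first by rewrite lt_i2 andbT !leqW.
    case/andP; rewrite leq_eqVlt => /orP[/eqP->//|].
    rewrite leq_eqVlt => /orP[/eqP<-|]; first by rewrite v_i1.
    rewrite leq_eqVlt => /orP[/eqP<-|]; first by rewrite v_i2.
    by move=> gt_m le_m; move: (leq_trans gt_m le_m); rewrite ltnn.
  rewrite v_i in eq_i.
  have gt2 : 2 < run_length i' j'.
    by rewrite /run_length ltnS ltn_subRL addn1 (leq_trans _ le_j).
  have [pre suf] := ends _ _ (conj run eq_i).
  have [] := inner _ _ run.
  - by move=> /pre; rewrite leqNgt (ltnW gt2).
  - by move=> /suf; rewrite leqNgt gt2.
  by move=> /(_ (conj run eq_i)); rewrite leqNgt gt2.
(* A factor 121: its middle letter is a whole inner run. *)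
have run : is_run v i.+1 i.+1.
  apply/is_runP; split=> /=; rewrite ?v_i ?v_i1 ?v_i2 //.
  split=> [|m]; first by rewrite leqnn ltnW.
  by rewrite -eqn_leq => /eqP<-.
have [] := inner _ _ run.
- by case.
- by case=> _ eq_i; rewrite eq_i ltnn in lt_i2.
by move=> _ /(_ (conj run v_i1)); rewrite /run_length subnn.
Qed.

Theorem theorem4p2 (n : nat) (v : seq nat) :
  (positive_word v /\ no_consecutive_ones n (foata v)) <->
  [/\ word12 v, size v = n, end_runs_condition v & inner_runs_condition v].
Proof.
rewrite /no_consecutive_ones {1}/word12 (perm_all _ (perm_foata v)).
rewrite (perm_size (perm_foata v)) -/(word12 v) -/(has11 (foata v)).
split=> [[_ /and3P[v12 /eqP sz /(foata_spread_ones v12)]]|[v12 sz ends inner]].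
  by case/(spread_ones_runs v12).
split; first by apply: sub_all v12 => c; rewrite !inE => /orP[]/eqP->.
apply/and3P; split=> //; first exact/eqP.
exact/(foata_spread_ones v12)/(spread_ones_runs v12).
Qed.
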